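(* Let $P$ be a law on environments $\omega=(\omega_x)_{x\in\mathbb Z}$ such that: (i) under $P$ the $\omega_x$, $x\in\mathbb Z$, are i.i.d. and there is a constant $c>0$ with $P(\omega_x\in[c,1-c])=1$; (ii) $\omega_{\min}>1/2$ and $\alpha:=P(\omega_0=\omega_{\min})\in(0,1)$; (iii) there exists $\eta>0$ such that $P(\omega_0\in(\omega_{\min},\omega_{\min}+\eta))=0$. Let $I(0):=-\frac12\ln\big(4\omega_{\min}(1-\omega_{\min})\big)$. Then $$\lim_{n\to\infty}\frac{(\ln n)^2}{n}\big\{\ln P_\omega(X_{2n}=0)+2nI(0)\big\}=-|\pi\ln\alpha|^2,\qquad P\text{-a.s.}$$
   Context: An environment is $\omega=(\omega_x)_{x\in\mathbb Z}\in(0,1)^{\mathbb Z}$; $P$ is a probability law on environments, and $\omega_{\min}:=\inf\{x: P(\omega_0\le x)>0\}$. Given $\omega$, the random walk in random environment $(X_n)_{n\ge0}$ is, under the quenched law $P_\omega$, the time-homogeneous Markov chain on $\mathbb Z$ with $X_0=0$ that from site $x$ jumps to $x+1$ with probability $\omega_x$ and to $x-1$ with probability $1-\omega_x$. *)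

(* Defs.v *)
From HB Require Import structures.
From mathcomp Require Import all_boot all_order all_algebra.
From mathcomp Require Import all_classical all_reals all_analysis.

Set Implicit Arguments.
Unset Strict Implicit.
Unset Printing Implicit Defensive.

Import Order.TTheory GRing.Theory Num.Theory.
Import numFieldNormedType.Exports.

Local Open Scope classical_set_scope.
Local Open Scope ring_scope.

Record environment (R : realType) := Environment {
  site :> int -> R;
  site01 : forall x, 0 < site x < 1 }.

Section environment_measurable.
Context (R : realType).

HB.instance Definition _ := gen_eqMixin (environment R).
HB.instance Definition _ := gen_choiceMixin (environment R).

Fact half01 (x : int) : 0 < (2^-1 : R) < 1.
Proof. by rewrite invr_gt0 ltr0n invf_lt1 ?ltr0n// ltr1n. Qed.

HB.instance Definition _ :=
  isPointed.Build (environment R) (Environment half01).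

Definition cylinders : set (set (environment R)) :=
  [set C | exists x (B : set (measurableTypeR R)),
     measurable B /\ C = [set w : environment R | B (w x)]].

(* The sigma-algebra on environments is the product one, that is, the one
   generated by the coordinate maps. *)
HB.instance Definition _ := Measurable.copy (environment R)
  (g_sigma_algebraType cylinders).

End environment_measurable.

Section random_environment.
Context (R : realType).
Implicit Types P : probability (environment R) R.

Definition independent_sites P : Prop :=
  forall (s : seq int) (B : int -> set (measurableTypeR R)),
    uniq s -> (forall x, measurable (B x)) ->
    P [set w : environment R | forall x, x \in s -> B x (w x)] =
    (\prod_(x <- s) P [set w : environment R | B x (w x)])%E.

Definition identically_distributed_sites P : Prop :=
  forall (x y : int) (B : set (measurableTypeR R)), measurable B ->
    P [set w : environment R | B (w x)] = P [set w : environment R | B (w y)].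

Definition iid_sites P : Prop :=
  independent_sites P /\ identically_distributed_sites P.

Definition omega_min P : R := inf [set x : R | (0 < P [set w : environment R | (w 0 <= x)%R])%E].

Definition alpha P : R := fine (P [set w : environment R | w 0 = omega_min P]).

Definition I0 P : R := - 2^-1 * ln (4 * omega_min P * (1 - omega_min P)).

End random_environment.

Section quenched_walk.
Context (R : realType).

Definition jump (w : environment R) (x y : int) : R :=
  if y == x + 1 then w x else if y == x - 1 then 1 - w x else 0.

(* Under Q, the process X is the time-homogeneous Markov chain on the integers
   started at 0 with transition probabilities [jump w].  The Markov property
     Q (X_{n+1} = y | X_0 = x_0, ..., X_n = x_n) = jump w x_n y
   is multiplied by the probability of the conditioning event, so that null
   histories carry no constraint. *)
Definition is_walk_in (w : environment R) d (T : measurableType d)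
    (X : nat -> T -> int) (Q : probability T R) : Prop :=
  [/\ forall n x, measurable [set t | X n t = x],
      Q [set t | X 0%N t = 0] = 1%E &
      forall n (x : nat -> int) (y : int),
        Q [set t | (forall k, (k <= n)%N -> X k t = x k) /\ X n.+1 t = y] =
        (Q [set t | forall k, (k <= n)%N -> X k t = x k]
          * (jump w (x n) y)%:E)%E].

End quenched_walk.

(* Main.v *)
(* Let m be the minimum of omega, Lambda = - ln alpha, and let lambda = exp (- I0)
   = 2 sqrt (m (1 - m)) be the spectral radius of the walk in the constant
   environment m.  Killing that walk outside an interval of s - 1 sites lowers
   the radius to lambda cos (pi / s).  Among the first n sites the longest run of
   the value m has length about ln n / Lambda.

   Lower bound: by Borel-Cantelli a run of length ln n / kappa, kappa > Lambda,
   occurs at distance n ^ (Lambda / kappa) up to logarithms, so reaching it and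
   coming back costs a factor negligible at scale n / (ln n)^2; inside the run
   the killed eigenfunction is a subsolution.

   Upper bound: by Borel-Cantelli all runs in [-2n, 2n] are shorter than
   ln n / kappa, kappa < Lambda.  The killed eigenfunctions on the runs can then
   be glued into a positive supersolution f on [-2n, 2n] for an eigenvalue
   lambda cos (pi / (ln n / kappa + O(1))), since sites outside the runs have
   room to spare by the gap.  As f is compared with itself at 0, its size is
   irrelevant.

   Both bounds give - n (pi kappa / ln n)^2 to leading order; let kappa tend to
   Lambda. *)
Require Import Defs.
From HB Require Import structures.
From mathcomp Require Import all_boot all_order all_algebra.
From mathcomp Require Import all_classical all_reals all_analysis.
From mathcomp Require Import zify ring lra.

Set Implicit Arguments.
Unset Strict Implicit.
Unset Printing Implicit Defensive.

Import Order.TTheory GRing.Theory Num.Theory.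
Import numFieldNormedType.Exports.

Local Open Scope classical_set_scope.
Local Open Scope ring_scope.

(** * Return probabilities in a fixed environment and their lower bound *)

Section return_probability.
Context {R : realType}.
Implicit Types (w : int -> R) (c m h rho theta : R).

(** The recursion is on the first step, with target 0 and a varying starting point, so that sub- and
    supersolutions in [x] can be compared with it by induction on time. *)
Fixpoint return_prob w n x : R :=
  if n is k.+1 then
    w x * return_prob w k (x + 1) + (1 - w x) * return_prob w k (x - 1)
  else (x == 0)%:R.

Lemma return_prob_ge0 w n x : (forall x, 0 < w x < 1) -> 0 <= return_prob w n x.
Proof.
move=> w01; elim: n x => [|n IH] x /=; first exact: ler0n.
have /andP[w0 w1] := w01 x.
by rewrite addr_ge0 ?mulr_ge0 ?IH ?subr_ge0 // ltW.
Qed.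

Lemma le_return_prob_up w c n x : (forall x, 0 < w x < 1) -> c <= w x ->
  c * return_prob w n (x + 1) <= return_prob w n.+1 x.
Proof.
move=> w01 cw /=; have /andP[w0 w1] := w01 x.
by rewrite -[leLHS]addr0 lerD ?ler_wpM2r ?mulr_ge0 ?return_prob_ge0 ?subr_ge0 // ltW.
Qed.

Lemma le_return_prob_down w c n x : (forall x, 0 < w x < 1) -> c <= 1 - w x ->
  c * return_prob w n (x - 1) <= return_prob w n.+1 x.
Proof.
move=> w01 cw /=; have /andP[w0 w1] := w01 x.
by rewrite -[leLHS]add0r lerD ?ler_wpM2r ?mulr_ge0 ?return_prob_ge0 ?subr_ge0 // ltW.
Qed.

Lemma return_prob_gt0 w n x : (forall x, 0 < w x < 1) ->
  (`|x| <= n)%N -> ~~ odd (n + `|x|) -> 0 < return_prob w n x.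
Proof.
move=> w01; elim: n x => [|n IH] x xn px /=.
  by have -> : x = 0 by lia.
have /andP[w0 w1] := w01 x.
have [x0|x0] := leP x (-1).
  rewrite ltr_wpDr ?mulr_gt0 ?mulr_ge0 ?return_prob_ge0 ?subr_ge0 ?(ltW w1) //.
  by apply: IH; lia.
rewrite addrC; have [x0'|x0'] := leP 1 x.
  rewrite ltr_wpDr ?mulr_gt0 ?mulr_ge0 ?return_prob_ge0 ?subr_gt0 ?(ltW w0) //.
  by apply: IH; lia.
rewrite ltr_wpDr ?mulr_gt0 ?mulr_ge0 ?return_prob_ge0 ?subr_gt0 ?(ltW w0) //.
by apply: IH; lia.
Qed.

(** One path suffices: step down from every positive site and up from 0; parity makes it end at
    0. *)
Lemma return_prob_elliptic w c n (i : nat) : (forall x, 0 < w x < 1) ->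
  0 <= c -> (forall x, c <= w x <= 1 - c) ->
  (i <= n)%N -> ~~ odd (n + i) -> c ^+ n <= return_prob w n i%:Z.
Proof.
move=> w01 c0 cw; elim: n i => [|n IH] i.
  by rewrite leqn0 => /eqP ->.
have /andP[cwi wci] := cw i%:Z.
case: i cwi wci => [|i] cwi wci ni pi.
  apply: le_trans (le_return_prob_up n w01 cwi).
  by rewrite exprS ler_wpM2l // IH //; lia.
apply: le_trans (le_return_prob_down n w01 (_ : c <= _)); last by lra.
rewrite exprS ler_wpM2l //.
by rewrite (_ : i.+1%:Z - 1 = i%:Z) ?IH //; lia.
Qed.

Lemma return_prob_walk_right w c n k x : (forall x, 0 < w x < 1) ->
  0 <= c -> (forall x, c <= w x) ->
  c ^+ k * return_prob w n (x + k%:Z) <= return_prob w (k + n)%N x.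
Proof.
move=> w01 c0 cw; elim: k x => [|k IH] x; first by rewrite expr0 mul1r addr0.
apply: le_trans (le_return_prob_up (k + n) w01 (cw x)).
rewrite exprS -mulrA ler_wpM2l //.
by rewrite (_ : x + k.+1%:Z = x + 1 + k%:Z) ?IH //; lia.
Qed.

Lemma sin_three_term theta k :
  sin (theta * k.+2%:R) + sin (theta * k%:R) =
  2 * cos theta * sin (theta * k.+1%:R).
Proof.
have -> : theta * k.+2%:R = theta * k.+1%:R + theta by rewrite -[k.+2]addn1 natrD; ring.
have -> : theta * k%:R = theta * k.+1%:R - theta by rewrite -[k.+1]addn1 natrD; ring.
by rewrite sinD sinB; ring.
Qed.

(* [rho^i sin (theta (i + 1))] is an eigenfunction of the walk killed outside a
   run of constant environment [m], for the eigenvalue [2 h cos theta]. *)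
Lemma return_prob_run_induction w c m h rho theta N a M j i :
  (forall x, 0 < w x < 1) -> 0 <= c <= 1 -> (forall x, c <= w x <= 1 - c) ->
  m * rho = h -> 1 - m = h * rho -> 0 < rho <= 1 -> 0 <= h ->
  (forall k, (k <= M.*2)%N -> w (a + k)%N%:Z = m) -> (a + M.*2 <= N)%N ->
  theta = pi / M.+1.*2%:R -> (i <= M.*2)%N -> ~~ odd (N + j + (a + i)) ->
  c ^+ N * (2 * h * cos theta) ^+ j * (rho ^+ i * sin (theta * i.+1%:R))
    <= return_prob w (j + N) (a + i)%N%:Z.
Proof.
move=> w01 /andP[c0 c1] cw mrho mh /andP[rho0 rho1] h0 wm aN thE.
have th_gt0 : 0 < theta by rewrite thE divr_gt0 ?pi_gt0 // ltr0n; lia.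
have thpi : theta * (M.+1.*2)%:R = pi by rewrite thE divfK // pnatr_eq0; lia.
have sin_run_ge0 k : (k <= M.+1.*2)%N -> 0 <= sin (theta * k%:R).
  move=> kM; rewrite sin_ge0_pi // mulr_ge0 ?(ltW th_gt0) //=.
  by rewrite -thpi ler_wpM2l ?ler_nat ?(ltW th_gt0).
have cos0 : 0 <= cos theta.
  rewrite cos_ge0_pihalf //; apply/andP; split.
    by rewrite (le_trans _ (ltW th_gt0)) // oppr_le0 divr_ge0 ?pi_ge0.
  by rewrite thE ler_pM2l ?pi_gt0 // lef_pV2 ?posrE ?ltr0n ?ler_nat; lia.
(* The last [N] steps are the walk home, bounded by ellipticity at [j = 0]; the induction prepends
   steps inside the run. *)
elim: j i => [|j IH] i iM odd_i.
  rewrite expr0 mulr1 add0n.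
  apply: (@le_trans _ _ (c ^+ N)); last first.
    by apply: return_prob_elliptic => //; clear -iM odd_i aN; lia.
  rewrite ler_piMr ?exprn_ge0 // mulr_ile1 ?exprn_ge0 ?exprn_ile1 ?(ltW rho0) ?sin_le1 //.
  by apply: sin_run_ge0; lia.
rewrite addSn /= wm //.
have mh0 : 0 <= h * rho by rewrite mulr_ge0 // ltW.
have m0 : 0 <= m by rewrite -(pmulr_lge0 _ rho0) mrho.
have [A AE A0] : exists2 A, A = c ^+ N * (2 * h * cos theta) ^+ j & 0 <= A.
  by eexists; [reflexivity|rewrite mulr_ge0 ?exprn_ge0 ?mulr_ge0].
rewrite -AE in IH.
(* Just past the right end the sine is taken at pi, so the subsolution vanishes and positivity of
   [return_prob] suffices; to the left of the run the sine is taken at 0. *)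
have up : A * (rho ^+ i.+1 * sin (theta * i.+2%:R)) <=
    return_prob w (j + N) ((a + i)%N%:Z + 1).
  have [iM'|iM'] := ltnP i M.*2.
    rewrite (_ : _ + 1 = (a + i.+1)%N%:Z); last by clear; lia.
    by apply: IH; clear -iM' odd_i; lia.
  have -> : i.+2 = M.+1.*2 by clear -iM iM'; lia.
  by rewrite thpi sinpi mulr0 mulr0 return_prob_ge0.
have down : A * (rho ^+ i * sin (theta * i%:R)) <=
    rho * return_prob w (j + N) ((a + i)%N%:Z - 1).
  case: i iM odd_i {up} => [|i] iM odd_i.
    by rewrite mulr0 sin0 !mulr0 mulr_ge0 ?return_prob_ge0 // ltW.
  rewrite (_ : A * _ = rho * (A * (rho ^+ i * sin (theta * i.+1%:R)))); last by rewrite exprS; ring.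
  rewrite ler_pM2l // (_ : _ - 1 = (a + i)%N%:Z); last by clear; lia.
  by apply: IH; clear -iM odd_i; lia.
rewrite mh -(mulrA h); apply: le_trans (lerD (ler_wpM2l m0 up) (ler_wpM2l h0 down)).
rewrite le_eqVlt; apply/orP; left; apply/eqP.
rewrite (exprSr _ j) (mulrA (c ^+ N)) -AE.
have := sin_three_term theta i=> e.
transitivity (A * h * rho ^+ i * (2 * cos theta * sin (theta * i.+1%:R))); first by ring.
by rewrite -e exprS -mrho; ring.
Qed.

(** The [2 * n] steps split into a straight march to the middle of the run, where the sine is 1, a
    long stay inside the run, and [N] steps for coming home. March and return each contribute a
    factor of at least [c ^+ N]. *)
Lemma return_prob_lower w c m h rho N a M n :
  (forall x, 0 < w x < 1) -> 0 <= c <= 1 -> (forall x, c <= w x <= 1 - c) ->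
  m * rho = h -> 1 - m = h * rho -> 0 < rho <= 1 -> 0 <= 2 * h <= 1 ->
  (forall k, (k <= M.*2)%N -> w (a + k)%N%:Z = m) -> (a + M.*2 <= N)%N ->
  (N <= n)%N ->
  c ^+ (2 * N) * rho ^+ M * (2 * h * cos (pi / M.+1.*2%:R)) ^+ (2 * n)
    <= return_prob w (2 * n) 0.
Proof.
move=> w01 c01 cw mrho mh rho01 /andP[h0 h1] wm aN Nn.
have [c0 c1] := andP c01.
have [rho0 rho1] := andP rho01.
set theta := pi / _.
have th_gt0 : 0 < theta by rewrite divr_gt0 ?pi_gt0 // ltr0n; lia.
have thpi : theta * M.+1%:R = pi / 2.
  have : M.+1%:R != 0 :> R by rewrite pnatr_eq0.
  by rewrite /theta -muln2 natrM; move: (M.+1%:R : R) => k k0; field.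
have cos0 : 0 <= cos theta.
  rewrite cos_ge0_pihalf //; apply/andP; split.
    by rewrite (le_trans _ (ltW th_gt0)) // oppr_le0 divr_ge0 ?pi_ge0.
  by rewrite /theta ler_pM2l ?pi_gt0 // lef_pV2 ?posrE ?ltr0n ?ler_nat; lia.
pose y := (a + M)%N; pose j := (2 * n - y - N)%N.
have jE : (2 * n = y + (j + N))%N by rewrite /j /y; clear -aN Nn; lia.
have MM : (M <= M.*2)%N by clear; lia.
have odd_j : ~~ odd (N + j + (a + M)) by move: jE; clear; rewrite /y; lia.
have yN : (y <= N)%N by clear -aN; rewrite /y; lia.
have jn : (j <= 2 * n)%N by clear; rewrite /j; lia.
have hh : 0 <= h by rewrite -(pmulr_rge0 _ (ltr0n R 2)).
have := @return_prob_run_induction w c m h rho theta N a M j M w01 c01 cw mrho mh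
  rho01 hh wm aN erefl (_ : (M <= M.*2)%N) (_ : ~~ odd (N + j + (a + M))).
rewrite thpi sin_pihalf mulr1 => low.
have {}low := low MM odd_j.
 rewrite [X in return_prob w X _]jE.
apply: le_trans (@return_prob_walk_right w c (j + N) y 0 w01 c0 _); last first.
  by move=> x; case/andP: (cw x).
rewrite add0r.
apply: le_trans (ler_wpM2l (exprn_ge0 y c0) low).
rewrite mulrA mulrA -exprD mulrAC ler_pM2r ?exprn_gt0 //.
(* Both bases are at most 1, so the exponents [y + N] and [j] may be raised to [2 * N] and
   [2 * n]. *)
apply: ler_pM; rewrite ?exprn_ge0 ?mulr_ge0 //.
  by apply: ler_wiXn2l => //; rewrite mul2n -addnn leq_add2r.
apply: ler_wiXn2l; rewrite ?mulr_ge0 //.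
by rewrite mulr_ile1 ?mulr_ge0 ?cos_le1.
Qed.

End return_probability.

(** * Upper bound by a positive supersolution *)

Section supersolution.
Context {R : realType}.
Implicit Types (v : nat -> R) (m h rho theta : R).

(** Discrete monotonicity of sin x / x: the three-term recurrence passes it from [K] to [K.+1]
    because the cosine is at most 1. *)
Lemma sin_succ_le theta K : 0 <= theta -> theta * K%:R <= pi ->
  K%:R * sin (theta * K.+1%:R) <= K.+1%:R * sin (theta * K%:R).
Proof.
move=> th0; elim: K => [|K IH] thK; first by rewrite mul0r mulr0 sin0 mulr0.
have {}IH : K%:R * sin (theta * K.+1%:R) <= K.+1%:R * sin (theta * K%:R).
  by apply/IH/(le_trans _ thK); rewrite ler_wpM2l ?ler_nat.
have s0 : 0 <= sin (theta * K.+1%:R) by rewrite sin_ge0_pi // mulr_ge0.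
have e : sin (theta * K.+2%:R) = 2 * cos theta * sin (theta * K.+1%:R) - sin (theta * K%:R).
  by rewrite -sin_three_term addrK.
have : 0 <= 2 * K.+1%:R * sin (theta * K.+1%:R) * (1 - cos theta).
  by rewrite !mulr_ge0 // subr_ge0 cos_le1.
rewrite {}e; move: (sin (theta * K.+1%:R)) (sin _) (cos _) IH s0 => s t co.
have -> : K.+2%:R = K%:R + 2 :> R by rewrite -addn2 natrD.
have -> : K.+1%:R = K%:R + 1 :> R by rewrite -addn1 natrD.
by move: (K%:R : R) => k IH s0; nra.
Qed.

(** Site 0 gives 0 whatever its value: the barrier only has to be a supersolution from site 1 on. *)
Fixpoint run_length v m i : nat :=
  if i is j.+1 then if v j.+1 == m then (run_length v m j).+1 else 0 else 0.

Lemma run_lengthP v m i k : (k < run_length v m i)%N -> (k < i)%N /\ v (i - k)%N = m.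
Proof.
elim: i k => [|i IH] k //=.
case: eqP => // vm; case: k => [|k]; first by rewrite subn0.
by rewrite ltnS subSS => /IH.
Qed.

(* The ratio of consecutive values of the supersolution [barrier]: inside a run
   it follows the killed eigenfunction [rho ^ x sin (theta (C + k))], and it is
   reset to phase [C] at every site outside the runs.  The margin [C] keeps the
   ratio within a factor [(C + 1) / C] of [rho] at both ends of a run, which the
   gap above [m] absorbs. *)
Definition barrier_ratio rho theta C v m i : R :=
  rho * (sin (theta * (C + (run_length v m i).+1)%:R) /
         sin (theta * (C + run_length v m i)%:R)).

Definition barrier rho theta C v m i : R :=
  \prod_(0 <= j < i) barrier_ratio rho theta C v m j.

Variables (v : nat -> R) (m h rho theta : R) (C L n : nat).
Hypotheses (mrho : m * rho = h) (mh : 1 - m = h * rho) (rho0 : 0 < rho).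
Hypotheses (C0 : (0 < C)%N) (thetaE : theta = pi / (L + 1 + 2 * C)%N%:R).
Hypotheses (v01 : forall i, 0 < v i < 1).
Hypothesis gap : forall i, v i = m \/
  C.+1%:R / C%:R * (v i * rho + (1 - v i) / rho) <= 2 * h * cos theta.
Hypothesis short : forall i, (i <= n)%N -> (run_length v m i <= L)%N.

Let theta_gt0 : 0 < theta.
Proof. by rewrite thetaE divr_gt0 ?pi_gt0 // ltr0n addn_gt0 addn1. Qed.

Let theta_pi : theta * (L + 1 + 2 * C)%N%:R = pi.
Proof. by rewrite thetaE divfK // pnatr_eq0 addn1. Qed.

(** The phases in use run from [C] to [C + L + 1], strictly inside the half-period [L + 1 + 2 * C]
    of the sine. *)
Let sin_pos k : (k <= L.+1)%N -> 0 < sin (theta * (C + k)%N%:R).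
Proof.
move=> kL; rewrite sin_gt0_pi // mulr_gt0 ?ltr0n ?addn_gt0 ?C0 //=.
by rewrite -theta_pi ltr_pM2l // ltr_nat; lia.
Qed.

Let ratio_pos i : (i <= n)%N -> 0 < barrier_ratio rho theta C v m i.
Proof.
move=> /short iL; rewrite /barrier_ratio mulr_gt0 // divr_gt0 ?sin_pos //.
by rewrite (leq_trans iL).
Qed.

Lemma barrier_gt0 i : (i <= n.+1)%N -> 0 < barrier rho theta C v m i.
Proof.
elim: i => [|i IH] ni; first by rewrite /barrier big_geq.
by rewrite /barrier big_nat_recr //= mulr_gt0 ?ratio_pos ?IH // ltnW.
Qed.

(* By reflection in the middle of the interval, [sin_succ_le] also bounds the
   ratio of consecutive sines from below. *)
Let ratio_lower i : (i <= n)%N ->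
  rho <= C.+1%:R / C%:R * barrier_ratio rho theta C v m i.
Proof.
move=> /short; rewrite /barrier_ratio; move: (run_length _ _ _) => k kL.
have refl j j' : (j + j' = L + 1 + 2 * C)%N -> sin (theta * j%:R) = sin (theta * j'%:R).
  move=> e; have -> : theta * j%:R = pi - theta * j'%:R.
    by rewrite -theta_pi -e natrD; ring.
  by rewrite sinB sinpi cospi; ring.
have := @sin_succ_le theta (C + L - k) (ltW theta_gt0).
rewrite (refl (C + L - k).+1 (C + k)%N); last by lia.
rewrite (refl (C + L - k)%N (C + k).+1); last by lia.
have s0 := @sin_pos k (leqW kL).
have s1 : 0 < sin (theta * (C + k).+1%:R) by rewrite -addnS sin_pos.
have KE : (C + L - k)%N%:R = C%:R + (L - k)%N%:R :> R.
  by rewrite -natrD; congr _%:R; lia.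
have le_pi : theta * (C + L - k)%N%:R <= pi.
  by rewrite -theta_pi ler_pM2l // ler_nat; lia.
have KE1 : (C + L - k).+1%:R = C%:R + (L - k)%N%:R + 1 :> R by rewrite -natr1 KE.
move=> /(_ le_pi); rewrite {le_pi}KE {}KE1 addnS -[C.+1%:R]natr1.
have C0' : 0 < C%:R :> R by rewrite ltr0n.
have d0 : 0 <= (L - k)%N%:R :> R by [].
move: (sin (theta * (C + k)%:R)) (sin (theta * (C + k).+1%:R)) s0 s1 => s t s0 t0.
move: (C%:R : R) ((L - k)%N%:R : R) C0' d0.
move=> c d c0 d0 le_ts.
rewrite -[leLHS]mulr1 mulrCA ler_pM2l // mulrACA -invfM ler_pdivlMr ?mulr_gt0 // mul1r.
have cd0 : 0 < c + d by rewrite ltr_wpDr.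
rewrite -(ler_pM2l cd0); nra.
Qed.

Let ratio_reset i : run_length v m i = 0%N ->
  barrier_ratio rho theta C v m i <= rho * (C.+1%:R / C%:R).
Proof.
move=> r0; rewrite /barrier_ratio r0 addn1 addn0 ler_pM2l //.
have s0 : 0 < sin (theta * C%:R) by rewrite -[C]addn0 sin_pos.
rewrite ler_pdivrMr // mulrAC ler_pdivlMr ?ltr0n // mulrC.
apply: sin_succ_le; first exact: ltW.
by rewrite -theta_pi ler_pM2l // ler_nat; lia.
Qed.

(** Inside a run the sine recurrence gives equality. At any other site the two ratios involved
    differ from [rho] by at most the factor [q = (C + 1) / C] in the unfavourable direction, and
    [gap] absorbs this factor. *)
Lemma barrier_supersolution i : (i < n)%N ->
  v i.+1 * barrier rho theta C v m i.+2 + (1 - v i.+1) * barrier rho theta C v m i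
  <= 2 * h * cos theta * barrier rho theta C v m i.+1.
Proof.
move=> ni.
have Fi := barrier_gt0 (leqW (ltnW ni)).
have Fi1 : barrier rho theta C v m i.+1 =
    barrier rho theta C v m i * barrier_ratio rho theta C v m i.
  by rewrite {1}/barrier big_nat_recr.
have -> : barrier rho theta C v m i.+2 =
    barrier rho theta C v m i.+1 * barrier_ratio rho theta C v m i.+1.
  by rewrite {1}/barrier big_nat_recr.
rewrite Fi1.
set r := barrier_ratio _ _ _ _ _ i; set r' := barrier_ratio _ _ _ _ _ i.+1.
suff : v i.+1 * r * r' + (1 - v i.+1) <= 2 * h * cos theta * r.
  move=> /(ler_wpM2l (ltW Fi)); congr (_ <= _); ring.
have r0 : 0 < r := ratio_pos (ltnW ni).
have [vm|vm] := eqVneq (v i.+1) m.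
  rewrite vm /r /r' /barrier_ratio /= vm eqxx.
  have := short ni; rewrite /= vm eqxx; move: (run_length _ _ _) => k kL.
  have := @sin_pos k (leqW (ltnW kL)); have := @sin_pos k.+1 (leqW kL).
  rewrite !addnS; have := sin_three_term theta (C + k).
  move: (sin (theta * (C + k).+2%:R)) (sin (theta * (C + k)%:R)) (sin (theta * (C + k).+1%:R)).
  move=> s2 s0 s1 e s1_gt0 s0_gt0.
  rewrite mh le_eqVlt; apply/orP; left; apply/eqP.
  have -> : s2 = 2 * cos theta * s1 - s0 by rewrite -e addrK.
  by rewrite -mrho; field; rewrite !gt_eqF.
have [/eqP|good] := gap i.+1; first by rewrite (negbTE vm).
have := ratio_lower (ltnW ni); rewrite -/r => low.
have := @ratio_reset i.+1; rewrite /= (negbTE vm) => /(_ erefl); rewrite -/r' => up.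
have /andP[v0 v1] := v01 i.+1.
set q := _ / _ in low up good.
have q0 : 0 < q by rewrite divr_gt0 ?ltr0n.
have {}low : 1 <= q * r / rho by rewrite ler_pdivlMr // mul1r.
apply: le_trans (ler_wpM2r (ltW r0) good).
apply: (@le_trans _ _ (v i.+1 * r * (rho * q) + (1 - v i.+1) * (q * r / rho))).
  apply: lerD; first by rewrite ler_wpM2l // mulr_ge0 // ltW.
  by rewrite ler_peMr // subr_ge0 ltW.
by rewrite le_eqVlt; apply/orP; left; apply/eqP; ring.
Qed.

End supersolution.

(** Comparison principle: the indicator of 0 is at most F / F(0), and each step multiplies the
    supersolution F by at most the eigenvalue. *)
Lemma return_prob_upper (R : realType) (w : int -> R) m h rho theta C L n :
  (forall x, 0 < w x < 1) -> m * rho = h -> 1 - m = h * rho -> 0 < rho -> 0 < h ->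
  (0 < C)%N -> theta = pi / (L + 1 + 2 * C)%N%:R ->
  (forall x, w x = m \/
     C.+1%:R / C%:R * (w x * rho + (1 - w x) / rho) <= 2 * h * cos theta) ->
  (forall x : int, - (2 * n)%:Z <= x -> x + L%:Z <= (2 * n)%:Z ->
     exists2 k, (k <= L)%N & w (x + k%:Z) != m) ->
  return_prob w (2 * n) 0 <= (2 * h * cos theta) ^+ (2 * n).
Proof.
move=> w01 mrho mh rho0 h0 C0 thE gap runs.
(* Shifted so that index [2 * n] is the origin and 0, ..., [4 * n] is all that [2 * n] steps can
   visit. *)
pose v (i : nat) := w (i%:Z - (2 * n)%:Z).
have v01 i : 0 < v i < 1 by exact: w01.
have vgap i := gap (i%:Z - (2 * n)%:Z).
have short i : (i <= 4 * n)%N -> (run_length v m i <= L)%N.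
  (* Otherwise the [L + 1] sites ending at [i] would all carry [m], against [runs]. *)
  move=> iN; rewrite leqNgt; apply/negP => Li.
  have [Li' _] := run_lengthP Li.
  have h1 : - (2 * n)%:Z <= (i - L)%N%:Z - (2 * n)%:Z by clear; lia.
  have h2 : (i - L)%N%:Z - (2 * n)%:Z + L%:Z <= (2 * n)%:Z by clear -iN Li'; lia.
  have [k kL /eqP] := runs _ h1 h2; apply.
  have [_ <-] := @run_lengthP _ v m i (L - k) (leq_ltn_trans (leq_subr _ _) Li).
  by congr w; clear -kL Li'; lia.
pose F := barrier rho theta C v m.
have F0 i : (i <= (4 * n).+1)%N -> 0 < F i.
  exact: (@barrier_gt0 _ v m rho theta C L (4 * n)).
have cos0 : 0 <= cos theta.
  rewrite cos_ge0_pihalf // thE; apply/andP; split.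
    by rewrite (@le_trans _ _ 0) ?oppr_le0 ?divr_ge0 ?pi_ge0.
  by rewrite ler_pM2l ?pi_gt0 // lef_pV2 ?posrE ?ltr0n ?ler_nat; lia.
set lam := 2 * h * cos theta.
have lam0 : 0 <= lam by rewrite !mulr_ge0 // ltW.
(* In [j] steps from [i] only the sites between [i - j] and [i + j] are seen, so these constraints
   keep the induction inside the window. At [i = 2 * n] the positive factor [F (2 * n)] cancels. *)
suff bound j i : (j <= i)%N -> (i + j <= 4 * n)%N ->
    return_prob w j (i%:Z - (2 * n)%:Z) * F (2 * n)%N <= lam ^+ j * F i.
  have N4 : (2 * n + 2 * n <= 4 * n)%N by clear; lia.
  have N4' : (2 * n <= (4 * n).+1)%N by clear; lia.
  by have := bound _ _ (leqnn (2 * n)) N4; rewrite subrr ler_pM2r // F0.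
elim: j i => [|j IH] i ji ij.
  rewrite expr0 mul1r /=; case: eqP => [e|_].
    by rewrite mul1r (_ : i = (2 * n)%N) //; lia.
  by rewrite mul0r ltW // F0; lia.
case: i ji ij => // i ji ij.
have /andP[v0 v1] := v01 i.+1.
have up : return_prob w j (i.+2%:Z - (2 * n)%:Z) * F (2 * n)%N <= lam ^+ j * F i.+2.
  by apply: IH; lia.
have down : return_prob w j (i%:Z - (2 * n)%:Z) * F (2 * n)%N <= lam ^+ j * F i.
  by apply: IH; lia.
have iN : (i < 4 * n)%N by lia.
have super := @barrier_supersolution _ v m h rho theta C L (4 * n)
  mrho mh rho0 C0 thE v01 vgap short i iN.
rewrite /= -/(v i.+1).
rewrite (_ : _ + 1 = i.+2%:Z - (2 * n)%:Z); last by clear; lia.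
rewrite (_ : _ - _ - 1 = i%:Z - (2 * n)%:Z); last by clear; lia.
rewrite exprSr -mulrA.
apply: le_trans (ler_wpM2l (exprn_ge0 j lam0) super).
rewrite mulrDl mulrDr -!mulrA.
apply: lerD.
  by rewrite [leRHS]mulrCA ler_wpM2l // ltW.
by rewrite [leRHS]mulrCA ler_wpM2l // subr_ge0 ltW.
Qed.

(** * From the Markov chain to the recursion *)

Section markov.
Context {R : realType} {d : measure_display} {T : measurableType d}.
Variables (w : environment R) (X : nat -> T -> int) (Q : probability T R).
Hypothesis walk : is_walk_in w X Q.
Local Open Scope ereal_scope.

Let history n (x : nat -> int) := [set t | forall k, (k <= n)%N -> X k t = x k].

Let measurable_site n x : measurable [set t | X n t = x].
Proof. by case: walk. Qed.

Let measurable_history n x : measurable (history n x).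
Proof.
have -> : history n x = \bigcap_(k in [set k | (k <= n)%N]) [set t | X k t = x k].
  by apply/seteqP; split.
by apply: bigcap_measurableType => k _; exact: measurable_site.
Qed.

Let extend n (x : nat -> int) y k := if (k <= n)%N then x k else y.

Let history_extend n x y :
  history n x `&` [set t | X n.+1 t = y] = history n.+1 (extend n x y).
Proof.
apply/seteqP; split => [t [hx hy] k|t hx].
  rewrite leq_eqVlt => /predU1P[->|]; first by rewrite /extend ltnn.
  by rewrite ltnS => kn; rewrite /extend kn hx.
split=> [k kn|]; last by have := hx n.+1 (leqnn _); rewrite /extend ltnn.
by rewrite hx ?leqW // /extend kn.
Qed.

Let prob_step n x y : Q (history n x `&` [set t | X n.+1 t = y]) =
  Q (history n x) * (jump w (x n) y)%:E.
Proof. by case: walk => _ _; exact. Qed.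

Let split_by (A B : set T) : measurable A -> measurable B ->
  Q A = Q (A `&` B) + Q (A `\` B).
Proof. by move=> mA mB; rewrite addeC; exact: measureDI. Qed.

(* The two neighbours already exhaust the mass of a history, so the remaining
   sites need no summation. *)
Let split_step n x (E : set T) : measurable E ->
  Q (history n x `&` E) =
    Q (history n x `&` [set t | X n.+1 t = x n + 1]%R `&` E) +
    Q (history n x `&` [set t | X n.+1 t = x n - 1]%R `&` E).
Proof.
move=> mE; set H := history n x.
set U := [set t | X n.+1 t = _]; set D := [set t | X n.+1 t = x n - 1]%R.
have mH : measurable H by exact: measurable_history.
have mU : measurable U by exact: measurable_site.
have mD : measurable D by exact: measurable_site.
have UD0 : U `&` D = set0.
  by rewrite -subset0 => t [tU tD]; have : (x n + 1 = x n - 1)%R := etrans (esym tU) tD; clear; lia.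
have disj F : measurable F ->
    Q (F `&` (U `|` D)) = Q (F `&` U) + Q (F `&` D).
  move=> mF; rewrite setIUr measureU //; try exact: measurableI.
  by rewrite setIACA UD0 setI0.
have rest : Q (H `\` (U `|` D)) = 0.
  have -> : Q (H `\` (U `|` D)) = Q H - Q (H `&` (U `|` D)).
    apply: measureD => //; first exact: measurableU.
    by rewrite ltey_eq fin_num_measure.
  rewrite disj // !prob_step /jump eqxx; have -> : (x n - 1 == x n + 1)%R = false by lia.
  rewrite eqxx -ge0_muleDr ?lee_fin ?subr_ge0; last 2 first.
  - by have /andP[/ltW] := site01 w (x n).
  - by have /andP[_ /ltW] := site01 w (x n).
  by rewrite -EFinD [(_ + (1 - _))%R]addrC subrK mule1 subee // fin_num_measure.
rewrite (@split_by (H `&` E) (U `|` D)); [|exact: measurableI|exact: measurableU].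
rewrite disj; last exact: measurableI.
have -> : Q ((H `&` E) `\` (U `|` D)) = 0.
  apply: (subset_measure0 _ _ _ rest).
  - by apply: measurableD; [exact: measurableI|exact: measurableU].
  - by apply: measurableD => //; exact: measurableU.
  - by move=> t [[]].
by rewrite adde0 setIAC [X in _ + Q X]setIAC.
Qed.

(** Fixing the whole past up to time [n], not only the present site, lets the induction on [j] use
    the Markov property exactly as [is_walk_in] states it. *)
Let prob_history_return n x j : Q (history n x `&` [set t | X (j + n)%N t = 0%R]) =
  Q (history n x) * (return_prob w j (x n))%:E.
Proof.
elim: j n x => [|j IH] n x.
  rewrite add0n /=; case: eqP => [xn|xn].
    rewrite mule1; congr (Q _); apply/setIidPl => t /(_ n (leqnn n)) /= ->.
    exact: xn.
  rewrite mule0 (_ : _ `&` _ = set0) ?measure0 // -subset0 => t [] /(_ n (leqnn n)) /=.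
  by move=> -> /xn.
rewrite split_step; last exact: measurable_site.
rewrite !history_extend addSnnS !IH -!history_extend !prob_step /=.
have ext y : extend n x y n.+1 = y by rewrite /extend ltnn.
rewrite !ext /jump eqxx; have -> : (x n - 1 == x n + 1)%R = false by lia.
rewrite eqxx -!muleA -!EFinM.
have /andP[/ltW w0 /ltW w1] := site01 w (x n).
rewrite -ge0_muleDr ?lee_fin ?mulr_ge0 ?subr_ge0 ?return_prob_ge0 //; exact: site01.
Qed.

(** The history of length 0 at the origin has full probability, so restricting to it loses a null
    set. *)
Lemma prob_return j : Q [set t | X j t = 0%R] = (return_prob w j 0%R)%:E.
Proof.
have Q0 : Q (history 0 (fun=> 0%R)) = 1.
  case: walk => _ <- _; congr (Q _); apply/seteqP; split => t.
    exact.
  by move=> /= t0 k; rewrite leqn0 => /eqP ->.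
have := prob_history_return 0 (fun=> 0%R) j.
rewrite Q0 mul1e addn0 => <-.
have Hc0 : Q (~` history 0 (fun=> 0%R)) = 0 by rewrite probability_setC // Q0 subee.
rewrite (@split_by [set t | X j t = 0%R] (history 0 (fun=> 0%R))) //.
rewrite setIC (_ : Q (_ `\` _) = 0) ?adde0 //.
apply: (@subset_measure0 _ _ _ _ _ (~` history 0 (fun=> 0%R))).
- exact: measurableD.
- exact: measurableC.
- by move=> t [].
- exact: Hc0.
Qed.

End markov.

(** * Almost sure properties of the environment *)

Lemma borel_cantelli_geometric d (T : measurableType d) (R : realType)
    (P : probability T R) (F : (set T)^nat) (K q : R) :
  (forall n, measurable (F n)) -> 0 <= K -> 0 <= q < 1 ->
  (forall n, P (F n) <= (K * q ^+ n)%:E)%E ->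
  {ae P, forall t, exists N, forall n, (N <= n)%N -> ~ F n t}.
Proof.
move=> mF K0 /andP[q0 q1] PF.
have q1' : 0 < 1 - q by rewrite subr_gt0.
have mlim : measurable (lim_sup_set F).
  apply: bigcap_measurableType => n _.
  by apply: bigcup_measurable => k _.
exists (lim_sup_set F); split => //; last first.
  move=> t /= nt n _.
  have /existsNP[k /not_implyP[nk /contrapT Fk]] : ~ forall k, (n <= k)%N -> ~ F k t.
    by move=> h; apply: nt; exists n.
  by exists k.
apply: lim_sup_set_cvg0 => //.
apply: (@le_lt_trans _ _ (K / (1 - q))%:E); last exact: ltry.
apply: lime_le; first by apply: is_cvg_nneseries => n _ _; exact: measure_ge0.
apply: nearW => n.
(* The exact geometric partial sum is carried so that the induction closes. *)
suff : (\sum_(0 <= i < n) P (F i) <= (K * (1 - q ^+ n) / (1 - q))%:E)%E.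
  move=> /le_trans; apply; rewrite lee_fin ler_pM2r ?invr_gt0 //.
  by rewrite ler_piMr // lerBlDr lerDl exprn_ge0.
elim: n => [|n IH]; first by rewrite big_geq // expr0 subrr mulr0 mul0r.
rewrite big_nat_recr //=; apply: le_trans (leeD IH (PF n)) _.
rewrite -EFinD lee_fin le_eqVlt; apply/orP; left; apply/eqP.
by rewrite exprS; field; rewrite subr_eq0 eq_sym lt_eqF.
Qed.

Section random_environment.
Context {R : realType}.
Variable P : probability (environment R) R.
Hypothesis iid : iid_sites P.
Hypothesis alpha01 : 0 < alpha P < 1.
Local Notation m := (omega_min P).

Lemma measurable_coordinate x (B : set (measurableTypeR R)) :
  measurable B -> measurable [set w : environment R | B (w x)].
Proof. by move=> mB; apply: sub_sigma_algebra; exists x, B. Qed.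

Definition all_min (s : seq int) : set (environment R) :=
  [set w | forall x, x \in s -> w x = m].

Lemma measurable_min x : measurable [set w : environment R | w x = m].
Proof. exact: (@measurable_coordinate x [set m] (measurable_set1 m)). Qed.

Lemma measurable_all_min s : measurable (all_min s).
Proof.
elim: s => [|x s IH].
  by rewrite (_ : all_min [::] = setT) //; apply/seteqP; split.
rewrite (_ : all_min _ = [set w : environment R | w x = m] `&` all_min s).
  by apply: measurableI => //; exact: measurable_min.
apply/seteqP; split => [w wm|w [wx wm] y]; last first.
  by rewrite inE => /predU1P[->|/wm].
by split=> [|y ys]; apply: wm; rewrite inE ?eqxx ?ys ?orbT.
Qed.

Lemma prob_all_min s : uniq s -> P (all_min s) = (alpha P ^+ size s)%:E.
Proof.
have [ind ident] := iid => us.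
have := ind s (fun=> [set m]) us (fun=> measurable_set1 m).
have -> : [set w : environment R | forall x, x \in s -> [set m] (w x)] = all_min s by [].
move=> ->; rewrite (eq_bigr (fun=> (alpha P)%:E)) => [|x _].
  by elim: (s) => [|x t IH]; rewrite ?big_nil // big_cons IH -EFinM -exprS.
rewrite (ident x 0 [set m]); last exact: measurable_set1.
by rewrite /alpha fineK ?fin_num_measure //; exact: measurable_min.
Qed.

(** Blocks with different [b] are disjoint, which makes their events independent. *)
Definition block l b : seq int := [seq (b * l + k)%N%:Z | k <- iota 0 l].

Lemma block_uniq l b : uniq (block l b).
Proof. by rewrite map_inj_uniq ?iota_uniq // => i j []; lia. Qed.

Definition no_block l B : set (environment R) :=
  [set w | forall b, (b < B)%N -> ~ all_min (block l b) w].

Lemma no_blockS l B : no_block l B.+1 = no_block l B `\` all_min (block l B).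
Proof.
apply/seteqP; split => [w nb|w [nb nB] b].
  by split=> [b bB|]; apply: nb; rewrite // ltnW.
by rewrite ltnS leq_eqVlt => /predU1P[->|/nb].
Qed.

Lemma measurable_no_block l B : measurable (no_block l B).
Proof.
elim: B => [|B IH].
  by rewrite (_ : no_block l 0 = setT) //; apply/seteqP; split.
by rewrite no_blockS; apply: measurableD => //; exact: measurable_all_min.
Qed.

(* Carrying along the event [all_min s] for sites beyond the blocks makes the
   induction go through using only the product rule for cylinders. *)
Lemma prob_no_block_all_min l B s : uniq s -> all (fun x : int => (B * l)%:Z <= x) s ->
  P (no_block l B `&` all_min s) = ((1 - alpha P ^+ l) ^+ B * alpha P ^+ size s)%:E.
Proof.
elim: B s => [|B IH] s us bs.
  rewrite (_ : no_block l 0 = setT); last by apply/seteqP; split.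
  by rewrite setTI expr0 mul1r prob_all_min.
have bs' : all (fun x : int => (B * l)%:Z <= x) s.
  by apply: sub_all bs => x; lia.
have us' : uniq (block l B ++ s).
  rewrite cat_uniq block_uniq us andbT /=; apply/hasPn => x /(allP bs) /= xs.
  by apply/negP => /mapP[k]; rewrite mem_iota => kl xE; move: kl xs; rewrite xE; lia.
have bs'' : all (fun x : int => (B * l)%:Z <= x) (block l B ++ s).
  by rewrite all_cat bs' andbT; apply/allP => x /mapP[k _ ->]; lia.
have mI : measurable (no_block l B `&` all_min s).
  by apply: measurableI; [exact: measurable_no_block|exact: measurable_all_min].
rewrite no_blockS setIDAC setIDA.
transitivity (P (no_block l B `&` all_min s)
    - P (no_block l B `&` all_min s `&` all_min (block l B)))%E.
  apply: measureD => //; first exact: measurable_all_min.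
  by rewrite ltey_eq fin_num_measure.
rewrite -setIA (_ : all_min s `&` _ = all_min (block l B ++ s)); last first.
  apply/seteqP; split => [w [ws wb] x|w ws].
    by rewrite mem_cat => /orP[/wb|/ws].
  by split=> x xs; apply: ws; rewrite mem_cat xs ?orbT.
rewrite !IH // -EFinB size_cat size_map size_iota; congr _%:E.
by rewrite exprD exprS; ring.
Qed.

Lemma prob_no_block l B : P (no_block l B) = ((1 - alpha P ^+ l) ^+ B)%:E.
Proof.
have := @prob_no_block_all_min l B [::] erefl erefl; rewrite expr0 mulr1 => <-.
by congr (P _); rewrite (_ : all_min [::] = setT) ?setIT //; apply/seteqP; split.
Qed.

(** With this many blocks of length [2M + 1], the expected number of blocks filled with the minimum
    exceeds [M], so by 1 - x <= exp (- x) there is none with probability at most exp (- M). *)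
Definition block_count M : nat := (Num.trunc (M%:R / alpha P ^+ M.*2.+1)).+1.

Lemma ae_long_run : {ae P, forall w : environment R, exists M0, forall M, (M0 <= M)%N ->
  exists2 b, (b < block_count M)%N &
    forall k, (k <= M.*2)%N -> w (b * M.*2.+1 + k)%N%:Z = m}.
Proof.
have /andP[a0 a1] := alpha01.
apply: filterS (@borel_cantelli_geometric _ _ R P
  (fun M => no_block M.*2.+1 (block_count M)) 1 (expR (-1)) _ _ _ _).
- move=> w [N Nw]; exists N => M NM.
  have /existsNP[b /not_implyP[bB /contrapT bw]] := Nw M NM.
  exists b => // k kM; apply: bw; apply/mapP; exists k => //.
  by rewrite mem_iota.
- by move=> M; exact: measurable_no_block.
- exact: ler01.
- by rewrite expR_ge0 expR_lt1; lra.
move=> M; rewrite prob_no_block mul1r lee_fin -expRM_natl.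
set l := M.*2.+1; have al0 : 0 < alpha P ^+ l by rewrite exprn_gt0.
have al1 : alpha P ^+ l <= 1 by rewrite exprn_ile1 // ltW.
apply: (@le_trans _ _ (expR (- alpha P ^+ l) ^+ block_count M)).
  by rewrite lerXn2r ?nnegrE ?expR_ge0 ?subr_ge0 // expR_ge1Dx.
rewrite -expRM_natl ler_expR mulrN mulrN1 lerN2.
rewrite -ler_pdivrMr // ltW // /block_count.
by apply: truncnS_gt.
Qed.

(** Inverse to the length scale of runs: for [L] near ln n / kappa this radius is of order n. *)
Definition window (kappa : R) L : nat := Num.trunc (expR (kappa * L%:R)).

Definition long_run kappa L : set (environment R) :=
  \big[setU/set0]_(i < (window kappa L).*2.+1)
    all_min [seq i%:Z - (window kappa L)%:Z + k%:Z | k <- iota 0 L.+1].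

(** Union bound: with K at most exp (kappa L), each of the 2K + 1 starting points contributes alpha
    ^ (L + 1), in total at most 3 (exp (kappa) alpha) ^ L. The ratio is below 1 because kappa < - ln
    alpha. *)
Lemma ae_no_long_run kappa : kappa < - ln (alpha P) -> 0 <= kappa ->
  {ae P, forall w : environment R, exists L0, forall L, (L0 <= L)%N ->
    forall x : int, (`|x| <= window kappa L)%N -> exists2 k, (k <= L)%N & w (x + k%:Z) != m}.
Proof.
have /andP[a0 a1] := alpha01 => ka k0.
have ea : expR kappa * alpha P < 1.
  by rewrite -[alpha P]lnK ?posrE // -expRD expR_lt1; lra.
have ms K L (i : nat) : measurable (all_min [seq i%:Z - K%:Z + k%:Z | k <- iota 0 L]).
  exact: measurable_all_min.
apply: filterS (@borel_cantelli_geometric _ _ R P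
  (long_run kappa) 3 (expR kappa * alpha P) _ _ _ _).
- move=> w [N Nw]; exists N => L NL x xK; apply: contrapT => nex.
  apply: (Nw L NL); rewrite /long_run; set K := window kappa L in xK *.
  rewrite -(bigcup_mkord _ (fun i : nat => all_min [seq i%:Z - K%:Z + k%:Z | k <- iota 0 L.+1])).
  exists (absz (x + K%:Z)); first by rewrite /=; lia.
  move=> y /mapP[k]; rewrite mem_iota add0n ltnS => /andP[_ kL] ->.
  apply: contrapT => /eqP wne; apply: nex; exists k => //.
  by rewrite (_ : x + k%:Z = (absz (x + K%:Z))%:Z - K%:Z + k%:Z) //; lia.
- by move=> L; apply: bigsetU_measurable => i _; exact: ms.
- by [].
- by rewrite ea andbT mulr_ge0 ?expR_ge0 // ltW.
move=> L; set K := window kappa L.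
pose F (i : nat) := all_min [seq i%:Z - K%:Z + k%:Z | k <- iota 0 L.+1].
apply: le_trans (@Boole_inequality _ _ _ P F K.*2.+1 (fun i _ => ms K L.+1 i)) _.
have PF i : P (F i) = (alpha P ^+ L.+1)%:E.
  rewrite prob_all_min ?size_map ?size_iota //.
  by rewrite map_inj_uniq ?iota_uniq // => j k; lia.
rewrite (eq_bigr (fun=> (alpha P ^+ L.+1)%:E)); last by move=> i _; exact: PF.
have -> : 3 * (expR kappa * alpha P) ^+ L = 3 * expR (kappa * L%:R) * alpha P ^+ L.
  by rewrite exprMn -expRM_natl [L%:R * _]mulrC mulrA.
rewrite sumEFin sumr_const card_ord lee_fin -[leLHS]mulr_natl.
have wK : K%:R <= expR (kappa * L%:R).
  by rewrite /K /window truncn_le // expR_ge0.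
have e1 : 1 <= expR (kappa * L%:R) by rewrite -[leLHS]expR0 ler_expR mulr_ge0.
apply: (@le_trans _ _ (K.*2.+1%:R * alpha P ^+ L)).
  by rewrite exprSr mulrA ler_piMr ?mulr_ge0 ?exprn_ge0 ?(ltW a0) ?(ltW a1).
rewrite ler_wpM2r ?exprn_ge0 ?(ltW a0) //.
rewrite -addn1 natrD -muln2 natrM; lra.
Qed.

Lemma ae_all_sites (B : set (measurableTypeR R)) : measurable B ->
  P [set w : environment R | B (w 0)] = 0%E ->
  {ae P, forall w : environment R, forall x, ~ B (w x)}.
Proof.
move=> mB B0; have [_ ident] := iid.
have Bx x : {ae P, forall w : environment R, ~ B (w x)}.
  exists [set w : environment R | B (w x)]; split.
  - exact: measurable_coordinate.
  - by rewrite (ident x 0).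
  - by move=> w /contrapT.
have pos := ae_foralln (fun n => Bx n%:Z); have neg := ae_foralln (fun n => Bx (Negz n)).
by apply: filterS2 pos neg => w wp wn [] n; [exact: wp|exact: wn].
Qed.

Lemma ae_elliptic c : P [set w : environment R | c <= w 0 <= 1 - c] = 1%E ->
  {ae P, forall w : environment R, forall x, c <= w x <= 1 - c}.
Proof.
move=> Pc; have mB : measurable (~` [set` `[c, 1 - c]] : set (measurableTypeR R)).
  by apply: measurableC; exact: measurable_itv.
apply: filterS (ae_all_sites mB _) => [w wB x|].
  by have /contrapT := wB x; rewrite /= in_itv.
have -> : [set w : environment R | (~` [set` `[c, 1 - c]]) (w 0)] =
    ~` [set w : environment R | c <= w 0 <= 1 - c].
  by apply/seteqP; split => w /=; rewrite in_itv.
rewrite probability_setC ?Pc ?subee //.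
rewrite (_ : [set w : environment R | _] = [set w : environment R | [set` `[c, 1 - c]] (w 0)]).
  by apply: measurable_coordinate; exact: measurable_itv.
by apply/seteqP; split => w /=; rewrite in_itv.
Qed.

Lemma omega_min_attained : exists w : environment R, w 0 = m.
Proof.
apply: contrapT => nex; have /andP[a0 _] := alpha01.
move: a0; rewrite /alpha (_ : [set w : environment R | _] = set0) ?measure0 ?ltxx //.
by rewrite -subset0 => w' /= wm; apply: nex; exists w'.
Qed.

Lemma omega_min01 : 0 < m < 1.
Proof. by have [w wm] := omega_min_attained; have := site01 w 0; rewrite wm. Qed.

Lemma prob_below_omega_min r : r < m -> P [set w : environment R | w 0 <= r] = 0%E.
Proof.
move=> rm; apply/eqP; rewrite eq_le measure_ge0 andbT leNgt; apply/negP => Pr.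
suff : m <= r by rewrite leNgt rm.
(* The infimum is over a set bounded below by 0, as all site values are positive. *)
apply: ge_inf => //; exists 0 => y /= Py; rewrite leNgt; apply/negP => y0.
move: Py; rewrite (_ : [set w : environment R | _] = set0) ?measure0 ?ltxx //.
rewrite -subset0 => w /= wy; have /andP[w0 _] := site01 w 0.
by have := lt_trans (le_lt_trans wy y0) w0; rewrite ltxx.
Qed.

Lemma ae_gap eta : P [set w : environment R | m < w 0 < m + eta] = 0%E ->
  {ae P, forall w : environment R, forall x, w x = m \/ m + eta <= w x}.
Proof.
move=> Pgap.
have mB : measurable ([set` `]m, m + eta[] : set (measurableTypeR R)).
  exact: measurable_itv.
have nogap := @ae_all_sites [set` `]m, m + eta[] mB.
(* The values below [m] are exhausted by countably many half-lines, each of probability zero. *)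
have below : {ae P, forall w : environment R, forall k, forall x,
    ~ [set` `]-oo, m - k.+1%:R^-1]] (w x)}.
  apply: ae_foralln => k; apply: ae_all_sites; first exact: measurable_itv.
  have mk : m - k.+1%:R^-1 < m by rewrite ltrBlDr ltrDl invr_gt0.
  rewrite -[RHS](prob_below_omega_min mk).
  by congr (P _); apply/seteqP; split => w /=; rewrite in_itv.
apply: filterS2 (nogap _) below => [w w1 w2 x|].
  have [wm|mw|//] := ltgtP (w x) m; last by left.
    have [k] := ltr_add_invr wm; rewrite -ltrBrDr => wk.
    by exfalso; apply: (w2 k x); rewrite /= in_itv /= ltW.
  right; rewrite leNgt; apply/negP => we; apply: (w1 x).
  by rewrite /= in_itv /= mw we.
by rewrite -[RHS]Pgap; congr (P _); apply/seteqP; split => w /=; rewrite in_itv.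
Qed.

End random_environment.

(** * Asymptotics of the angle and of the travel cost *)

Section asymptotics.
Context {R : realType}.
Implicit Types (a theta : nat -> R) (kappa : R).

Lemma cvg_ln_nat : ln (n%:R : R) @[n --> \oo] --> +oo.
Proof.
apply/cvgryPge => A; near=> n.
rewrite -[A]expRK ler_ln ?posrE ?expR_gt0 //.
  by near: n; exact: nbhs_infty_ger.
by apply: lt_le_trans (expR_gt0 A) _; near: n; exact: nbhs_infty_ger.
Unshelve. all: by end_near. Qed.

(** The derivative of the sine at 0, read along a sequence; nonvanishing puts the sequence in
    punctured neighbourhoods. *)
Lemma cvg_sin_div theta : (\forall n \near \oo, theta n != 0) ->
  theta @ \oo --> (0 : R) -> (sin (theta n) / theta n) @[n --> \oo] --> (1 : R).
Proof.
move=> th0 thc.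
have D : derivable sin (0 : R) 1 by apply: ex_derive; exact: is_derive_sin.
have E : 'D_1 sin (0 : R) = 1 by rewrite derive_val cos0.
have {}D : (h^-1 *: ((sin \o shift (0 : R)) (h *: 1) - sin 0)) @[h --> 0^'] --> 'D_1 sin (0 : R).
  exact: D.
rewrite E in D.
have : (fun n => (theta n)^-1 *: ((sin \o shift (0 : R)) (theta n *: 1) - sin 0)) @ \oo --> (1 : R).
  apply: (cvg_comp theta (fun h : R => h^-1 *: ((sin \o shift (0 : R)) (h *: 1) - sin 0)) _ D).
  move=> A nA; have thA : \forall n \near \oo, theta n != 0 -> A (theta n) := thc _ nA.
  by apply: filterS2 thA th0 => n; exact.
apply: cvg_trans; apply: near_eq_cvg; near=> n.
transitivity ((theta n)^-1 * (sin (theta n * 1 + 0) - sin 0)); first by [].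
by rewrite mulr1 addr0 sin0 subr0 mulrC.
Unshelve. all: by end_near. Qed.

(** [a] stands for the length of a killing interval, equal to ln n / kappa up to a bounded error;
    dividing by [a], which diverges, removes the error. *)
Lemma cvg_ln_div a kappa D : 0 < kappa -> (forall n, 0 < a n) ->
  (forall n, (0 < n)%N -> `|kappa * a n - ln n%:R| <= D) ->
  (a n)^-1 @[n --> \oo] --> (0 : R) /\ (ln n%:R / a n) @[n --> \oo] --> kappa.
Proof.
move=> k0 a0 aD.
have ac : a @ \oo --> +oo.
  apply/cvgryPge => A.
  have /cvgryPge /(_ (kappa * A + D)) h := cvg_ln_nat.
  near=> n; rewrite -(ler_pM2l k0).
  have n0 : (0 < n)%N by near: n; exact: nbhs_infty_gt.
  have := aD n n0; rewrite ler_norml => /andP[+ _].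
  have : kappa * A + D <= ln n%:R by near: n; exact: h.
  lra.
have av : (a n)^-1 @[n --> \oo] --> (0 : R).
  by apply/gtr0_cvgV0 => //; near=> n.
split=> //.
have Dv : (D * (a n)^-1) @[n --> \oo] --> (0 : R).
  by rewrite -[X in _ --> X](mulr0 D); apply: cvgM => //; exact: cvg_cst.
rewrite -(subr0 kappa).
apply: (@squeeze_cvgr _ \oo _ _ (fun n => kappa - D * (a n)^-1) (fun n => kappa + D * (a n)^-1)).
- near=> n.
  have n0 : (0 < n)%N by near: n; exact: nbhs_infty_gt.
  have := aD n n0; rewrite ler_norml => /andP[h1 h2].
  have an := a0 n.
  rewrite ler_pdivlMr // ler_pdivrMr // mulrBl mulrDl divfK ?gt_eqF //.
  by apply/andP; split; lra.
- by apply: cvgB => //; exact: cvg_cst.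
- by rewrite subr0 -[X in _ --> X]addr0; apply: cvgD => //; exact: cvg_cst.
Unshelve. all: by end_near. Qed.

Lemma cos_double (x : R) : cos x - 1 = - (2 * sin (x / 2) ^+ 2).
Proof.
have {1}-> : x = (x / 2) *+ 2 by rewrite mulr2n -splitr.
rewrite cos_mulr2n; have := cos2Dsin2 (x / 2); move: (cos _) (sin _) => s t e.
have -> : s ^+ 2 = 1 - t ^+ 2 by rewrite -e addrK.
by rewrite mulr2n; ring.
Qed.

Section angles.
Variables (a : nat -> R) (kappa D : R).
Hypotheses (kappa0 : 0 < kappa) (a0 : forall n, 0 < a n).
Hypothesis (aD : forall n, (0 < n)%N -> `|kappa * a n - ln n%:R| <= D).

Lemma cvg_angle : (pi / a n) @[n --> \oo] --> (0 : R).
Proof.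
have [av _] := cvg_ln_div kappa0 a0 aD.
by rewrite -[X in _ --> X](mulr0 pi); apply: cvgM => //; exact: cvg_cst.
Qed.

Lemma cvg_cos_angle : cos (pi / a n) @[n --> \oo] --> (1 : R).
Proof.
rewrite -[X in _ --> X]cos0.
by apply: (cvg_comp (fun n => pi / a n) cos cvg_angle); exact: continuous_cos.
Qed.

(** By the half-angle formula this is minus the square of (ln n / a) times pi times sin y / y at y =
    pi / (2a), and each factor converges. *)
Lemma cvg_ln_cos_angle :
  (2 * ln n%:R ^+ 2 * (cos (pi / a n) - 1)) @[n --> \oo] --> - (pi * kappa) ^+ 2.
Proof.
have [av lv] := cvg_ln_div kappa0 a0 aD.
have ang0 n : pi / a n / 2 != 0 :> R.
  by rewrite gt_eqF // !divr_gt0 ?pi_gt0.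
have sinc := @cvg_sin_div (fun n => pi / a n / 2) _ _.
have {}sinc : (sin (pi / a n / 2) / (pi / a n / 2)) @[n --> \oo] --> (1 : R).
  apply: sinc; first exact: nearW.
  rewrite -[X in _ --> X](mul0r 2^-1); apply: cvgM; [exact: cvg_angle|exact: cvg_cst].
have prod : ((ln n%:R / a n) * (pi * (sin (pi / a n / 2) / (pi / a n / 2)))) @[n --> \oo]
    --> kappa * (pi * 1).
  by apply: cvgM => //; apply: cvgM => //; exact: cvg_cst.
have sq : (fun n => - ((ln n%:R / a n) * (pi * (sin (pi / a n / 2) / (pi / a n / 2))) *
    ((ln n%:R / a n) * (pi * (sin (pi / a n / 2) / (pi / a n / 2)))))) @ \oo
    --> - ((kappa * (pi * 1)) * (kappa * (pi * 1))) := cvgN (cvgM prod prod).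
have -> : - (pi * kappa) ^+ 2 = - ((kappa * (pi * 1)) * (kappa * (pi * 1))) :> R by ring.
rewrite [X in X @ \oo](_ : _ = (fun n => - ((ln n%:R / a n) *
  (pi * (sin (pi / a n / 2) / (pi / a n / 2))) *
  ((ln n%:R / a n) * (pi * (sin (pi / a n / 2) / (pi / a n / 2))))))); first exact: sq.
apply/funext => n; rewrite cos_double.
have := lt0r_neq0 (pi_gt0 R); move: (sin _) => s; move: (@pi R) => p p0.
by field; rewrite p0 gt_eqF ?a0.
Qed.

End angles.

(** With t = 1 + ln n, the fifth-order term of the exponential series gives (delta t) ^ 5 <= 5! exp
    (delta t), so the product is at most K / t. *)
Lemma poly_expR_cvg0 (delta : R) : 0 < delta ->
  ((1 + ln n%:R) ^+ 4 * expR (- (delta * ln n%:R))) @[n --> \oo] --> (0 : R).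
Proof.
move=> d0; pose K := 5`!%:R * expR delta / delta ^+ 5.
have K0 : 0 <= K by rewrite /K !divr_ge0 ?mulr_ge0 ?expR_ge0 ?exprn_ge0 // ltW.
have lnp : (1 + ln (n%:R : R)) @[n --> \oo] --> +oo.
  apply/cvgryPge => A; have /cvgryPge /(_ A) h := cvg_ln_nat.
  near=> n; have : A <= ln n%:R by near: n; exact: h.
  lra.
have inv0 : (1 + ln (n%:R : R))^-1 @[n --> \oo] --> (0 : R).
  apply/gtr0_cvgV0 => //; near=> n.
  have : 1 <= 1 + ln (n%:R : R) by near: n; move/cvgryPge: lnp; exact.
  lra.
apply: (@squeeze_cvgr _ \oo _ _ (fun=> 0) (fun n => K * (1 + ln (n%:R : R))^-1)).
- near=> n.
  have t1 : 1 <= 1 + ln (n%:R : R) by near: n; move/cvgryPge: lnp; exact.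
  set t := 1 + ln _ in t1 *; have t0 : 0 < t by lra.
  rewrite mulr_ge0 ?exprn_ge0 ?expR_ge0 ?(ltW t0) //=.
  rewrite ler_pdivlMr // mulrAC -exprSr.
  have -> : ln n%:R = t - 1 by rewrite /t addrC addKr.
  have := @expR_ge1Dxn R (delta * t) 4 (mulr_ge0 (ltW d0) (ltW t0)).
  move=> h; have {h} : (delta * t) ^+ 5 <= 5`!%:R * expR (delta * t).
    rewrite -ler_pdivrMl ?ltr0n // mulrC; apply: le_trans h; lra.
  rewrite exprMn => h.
  have -> : - (delta * (t - 1)) = delta - delta * t by ring.
  rewrite expRD expRN mulrA ler_pdivrMr ?expR_gt0 //.
  have -> : K * expR (delta * t) = 5`!%:R * expR (delta * t) * expR delta / delta ^+ 5.
    by rewrite /K; ring.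
  rewrite ler_pdivlMr ?exprn_gt0 // mulrAC ler_wpM2r ?expR_ge0 // mulrC.
  exact: h.
- exact: cvg_cst.
- by rewrite -[X in _ --> X](mulr0 K); apply: cvgM => //; exact: cvg_cst.
Unshelve. all: by end_near. Qed.

(* Up to a polynomial factor in [ln n], blocks of length [ln n / kappa] are met
   within distance [n ^ (Lambda / kappa)], where [Lambda = - ln alpha]. *)
Lemma block_position_cvg0 (al kappa : R) (N M : nat -> nat) :
  0 < al < 1 -> - ln al < kappa ->
  (forall n, (0 < n)%N -> 2 * kappa * (M n)%:R <= ln n%:R) ->
  (forall n, (N n)%:R <= ((M n)%:R / al ^+ (M n).*2.+1 + 1) * (M n).*2.+1%:R) ->
  (ln n%:R ^+ 2 / n%:R * (N n)%:R) @[n --> \oo] --> (0 : R).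
Proof.
move=> /andP[a0 a1] ka Mn Nn.
have La : 0 < - ln al by rewrite oppr_gt0 ln_lt0 // a0 a1.
have k0 : 0 < kappa := lt_trans La ka.
(* With t = ln n, exp (t - delta t) is n ^ (Lambda / kappa); up to the factor 1 / al it bounds the
   inverse probability of a block. Positivity of [delta] is where kappa > Lambda enters. *)
pose delta := 1 - (- ln al) / kappa.
have d0 : 0 < delta by rewrite subr_gt0 ltr_pdivrMr // mul1r.
pose K1 := 1 + kappa^-1.
have kV : 0 < kappa^-1 by rewrite invr_gt0.
have K10 : 0 < K1 by rewrite addr_gt0.
pose K := (K1 / al + 1) * K1.
have K0 : 0 <= K by rewrite !mulr_ge0 ?addr_ge0 ?divr_ge0 // ltW.
apply: (@squeeze_cvgr _ \oo _ _ (fun=> 0)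
  (fun n => K * ((1 + ln n%:R) ^+ 4 * expR (- (delta * ln n%:R))))).
- near=> n.
  have n0 : (0 < n)%N by near: n; exact: nbhs_infty_gt.
  have nR : 0 < n%:R :> R by rewrite ltr0n.
  have nE : n%:R = expR (ln n%:R) :> R by rewrite lnK // posrE.
  have t0 : 0 <= ln n%:R :> R by rewrite ln_ge0 // ler1n.
  move: (Mn n n0) (Nn n); set t := ln n%:R in nE t0 *; set x := (M n)%:R => Mt Nt.
  have x0 : 0 <= x by rewrite /x.
  apply/andP; split; first by rewrite !mulr_ge0 ?exprn_ge0 ?invr_ge0.
  have xt : 2 * x <= t / kappa by rewrite ler_pdivlMr //; lra.
  have tk0 : 0 <= t / kappa by rewrite divr_ge0 // ltW.
  have xK : x <= K1 * (1 + t).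
    have : 0 <= kappa^-1 + t by rewrite addr_ge0 // ltW.
    rewrite /K1; lra.
  have lK : (M n).*2.+1%:R <= K1 * (1 + t).
    rewrite -addn1 natrD -muln2 natrM -/x.
    have : 0 <= kappa^-1 + t by rewrite addr_ge0 // ltW.
    rewrite /K1; lra.
  have e1 : 1 <= expR (t - delta * t).
    rewrite -[leLHS]expR0 ler_expR.
    have -> : t - delta * t = t * (- ln al) / kappa by rewrite /delta; ring.
    by rewrite divr_ge0 ?mulr_ge0 // ltW.
  have alE : (al ^+ (M n).*2.+1)^-1 <= al^-1 * expR (t - delta * t).
    rewrite exprS invfM ler_pM2l ?invr_gt0 //.
    rewrite -[X in X ^+ _]lnK ?posrE // -expRM_natl -expRN ler_expR.
    have -> : t - delta * t = (- ln al) * (t / kappa) by rewrite /delta; ring.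
    rewrite -mulrN mulrC ler_pM2l // -muln2 natrM -/x; lra.
  (* The factors [M n] and [2 * M n + 1] account for two of the four powers of 1 + t, the prefactor
     (ln n) ^ 2 for the other two. *)
  have N2 : (N n)%:R <= K * (1 + t) ^+ 2 * expR (t - delta * t).
    apply: (le_trans Nt).
    have -> : K * (1 + t) ^+ 2 * expR (t - delta * t) =
      ((K1 * (1 + t)) * (al^-1 * expR (t - delta * t)) + (1 + t) * expR (t - delta * t))
        * (K1 * (1 + t)) by rewrite /K; ring.
    apply: ler_pM => //.
      by rewrite addr_ge0 // mulr_ge0 // invr_ge0 exprn_ge0 // ltW.
    apply: lerD.
      by apply: ler_pM => //; rewrite invr_ge0 exprn_ge0 // ltW.
    rewrite -[leLHS]mulr1; apply: ler_pM => //; lra.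
  have t2 : t ^+ 2 <= (1 + t) ^+ 2 by rewrite lerXn2r ?nnegrE //; lra.
  rewrite mulrAC ler_pdivrMr //.
  have -> : K * ((1 + t) ^+ 4 * expR (- (delta * t))) * n%:R =
     (1 + t) ^+ 2 * (K * (1 + t) ^+ 2 * expR (t - delta * t)).
    by rewrite {1}nE addrC expRD -!/t; ring.
  by apply: ler_pM => //; rewrite exprn_ge0.
- exact: cvg_cst.
- rewrite -[X in _ --> X](mulr0 K); apply: cvgM; first exact: cvg_cst.
  exact: poly_expR_cvg0.
Unshelve. all: by end_near. Qed.

End asymptotics.

Lemma ln_le_subr1 (R : realType) (x : R) : 0 < x -> ln x <= x - 1.
Proof.
move=> x0; have x1 : -1 < x - 1 by rewrite ltrBrDr addNr.
by have := le_ln1Dx x1; rewrite [1 + _]addrC subrK.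
Qed.

Lemma ln_ge_subr1_div (R : realType) (x : R) : 0 < x -> (x - 1) / x <= ln x.
Proof.
move=> x0; have xV : 0 < x^-1 by rewrite invr_gt0.
have := ln_le_subr1 xV; rewrite lnV ?posrE // mulrBl mul1r mulfV ?gt_eqF //.
by rewrite lerNl opprB.
Qed.

(** * The two bounds on the logarithmic scale, for a fixed environment *)

Section quenched_asymptotics.
Context {R : realType}.
Variables (w : int -> R) (m c eta al : R).
Hypotheses (w01 : forall x, 0 < w x < 1) (m_half : 2^-1 < m) (m1 : m < 1).
Hypotheses (c0 : 0 < c) (cw : forall x, c <= w x <= 1 - c).
Hypotheses (eta0 : 0 < eta) (gap : forall x, w x = m \/ m + eta <= w x).
Hypothesis (al01 : 0 < al < 1).

(** Here h = sqrt (m (1 - m)) is half the spectral radius, and rho = sqrt ((1 - m) / m) is the tilt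
    that symmetrises the walk: m rho = (1 - m) / rho = h. *)
Let a := Num.sqrt m.
Let b := Num.sqrt (1 - m).
Let h := a * b.
Let rho := b / a.

Let m0 : 0 < m. Proof. by apply: lt_trans m_half; rewrite invr_gt0. Qed.
Let a0 : 0 < a. Proof. by rewrite sqrtr_gt0. Qed.
Let b0 : 0 < b. Proof. by rewrite sqrtr_gt0 subr_gt0. Qed.
Let a2 : a ^+ 2 = m. Proof. by rewrite sqr_sqrtr // ltW. Qed.
Let b2 : b ^+ 2 = 1 - m. Proof. by rewrite sqr_sqrtr // subr_ge0 ltW. Qed.
Let h0 : 0 < h. Proof. exact: mulr_gt0. Qed.
Let rho0 : 0 < rho. Proof. exact: divr_gt0. Qed.
Let mrho : m * rho = h.
Proof. by rewrite -a2 /rho /h; field; rewrite gt_eqF. Qed.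
Let mh : 1 - m = h * rho.
Proof. by rewrite -b2 /rho /h; field; rewrite gt_eqF. Qed.
Let rho1 : rho < 1.
Proof.
rewrite ltr_pdivrMr // mul1r /a /b ltr_sqrt //.
by move: m_half; lra.
Qed.
Let h2 : 4 * m * (1 - m) = (2 * h) ^+ 2.
Proof. by rewrite /h -b2 -a2; ring. Qed.
Let h2_le1 : 2 * h <= 1.
Proof.
have : (2 * h) ^+ 2 <= 1 by rewrite -h2; have := sqr_ge0 (2 * m - 1); nra.
by rewrite leNgt expr2 => sq; apply/negP => gt1; nra.
Qed.
Let c1 : c <= 1.
Proof. by have /andP[h1 h3] := cw 0; lra. Qed.

Definition log_deviation n : R := ln n%:R ^+ 2 / n%:R *
  (ln (return_prob w (2 * n) 0) +
   2 * n%:R * (- 2^-1 * ln (4 * m * (1 - m)))).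

Let rate : - 2^-1 * ln (4 * m * (1 - m)) = - ln (2 * h).
Proof. by rewrite h2 lnXn ?mulr_gt0 // -[ln _ *+ 2]mulr_natl; lra. Qed.

Let u_gt0 n : 0 < return_prob w (2 * n) 0.
Proof. by apply: return_prob_gt0 => //; rewrite absz0 addn0 oddM. Qed.

Lemma log_deviation_upper kappa : 0 < kappa ->
  (exists L0, forall L, (L0 <= L)%N -> forall x : int, (`|x| <= window kappa L)%N ->
     exists2 k, (k <= L)%N & w (x + k%:Z) != m) ->
  exists2 v : nat -> R, v @ \oo --> - (pi * kappa) ^+ 2 &
    \forall n \near \oo, log_deviation n <= v n.
Proof.
move=> k0 [L0 short].
(* The expression w rho + (1 - w) / rho equals 2h at w = m and decreases in w with slope - (1 / rho
   - rho); [gain] is its loss at w = m + eta. *)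
pose gain := eta * (rho^-1 - rho).
have gain0 : 0 < gain.
  by rewrite mulr_gt0 // subr_gt0 (lt_trans rho1) // invf_gt1.
(* Then C gain > 2h, whence (C + 1) (2h - gain) < 2h C: the gap beats the factor (C + 1) / C with
   room left for the cosine. *)
pose C := (Num.trunc (2 * h / gain)).+1.
have C0 : 0 < C%:R :> R by [].
have Cgain : 2 * h < C%:R * gain by rewrite -ltr_pdivrMr // /C truncnS_gt.
(* Rounding up makes the window of [L n] contain [-2n, 2n]; rounding and the margin change kappa s
   by a bounded amount. *)
pose L n := (Num.trunc (ln (2 * n)%N%:R / kappa)).+1.
pose s n : R := (L n + 1 + 2 * C)%N%:R.
have s0 n : 0 < s n by rewrite /s ltr0n addn_gt0 addn1.
have Ln n : (0 < n)%N -> ln (2 * n)%N%:R <= kappa * (L n)%:R <= ln (2 * n)%N%:R + kappa.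
  move=> n0; have l0 : 0 <= ln (2 * n)%N%:R / kappa.
    by rewrite divr_ge0 ?ln_ge0 ?(ltW k0) // ler1n muln_gt0.
  have /andP[lo hi] := truncn_itv l0; rewrite -/(L n) in hi.
  apply/andP; split; first by rewrite mulrC -ler_pdivrMr // ltW.
  rewrite /L -addn1 natrD mulrDr mulr1 lerD2r mulrC -ler_pdivlMr //.
have sD n : (0 < n)%N -> `|kappa * s n - ln n%:R| <= ln 2 + kappa * (2 + 2 * C%:R).
  move=> n0; have /andP[lo hi] := Ln n n0.
  have e : ln (2 * n)%N%:R = ln 2 + ln n%:R :> R by rewrite natrM lnM ?posrE ?ltr0n.
  have l2 : 0 <= ln 2 :> R by rewrite ln_ge0 // ler1n.
  have kC : 0 <= kappa * C%:R by rewrite mulr_ge0 // ltW.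
  rewrite e in lo hi; rewrite /s !natrD natrM ler_norml !mulrDr mulr1.
  by apply/andP; split; lra.
have cosc := cvg_cos_angle k0 s0 sD.
exists (fun n => 2 * ln n%:R ^+ 2 * (cos (pi / s n) - 1)).
  exact: cvg_ln_cos_angle k0 s0 sD.
have lnc := @cvg_ln_nat R.
near=> n.
have n0 : (0 < n)%N by near: n; exact: nbhs_infty_gt.
have nR : 0 < n%:R :> R by rewrite ltr0n.
have LnL0 : (L0 <= L n)%N.
  have le1 : kappa * L0%:R <= ln n%:R by near: n; move/cvgryPge: lnc; exact.
  have /andP[lo _] := Ln n n0; rewrite -(ler_nat R) -(ler_pM2l k0).
  apply: (le_trans le1); apply: le_trans lo.
  by rewrite ler_ln ?posrE ?ltr0n ?muln_gt0 // ler_nat leq_pmull.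
have cos0 : 2^-1 < cos (pi / s n).
  by near: n; apply: (cvgr_gt _ cosc); rewrite invf_lt1 ?ltr1n.
have cosC : C.+1%:R / C%:R * (2 * h - gain) / (2 * h) < cos (pi / s n).
  near: n; apply: (cvgr_gt _ cosc).
  rewrite ltr_pdivrMr ?mulr_gt0 // mul1r mulrAC ltr_pdivrMr //.
  by rewrite -natr1; have := mulr_gt0 C0 gain0; lra.
have wide : (2 * n <= window kappa (L n))%N.
  rewrite /window truncn_ge_nat ?expR_ge0 //.
  have /andP[lo _] := Ln n n0.
  by rewrite -[leLHS]lnK ?posrE ?ltr0n ?muln_gt0 // ler_expR.
have up : return_prob w (2 * n) 0 <= (2 * h * cos (pi / s n)) ^+ (2 * n).
  apply: (@return_prob_upper _ w m h rho (pi / s n) C (L n) n) => //.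
    move=> x; have [|wx] := gap x; [by left|right].
    have {}wx : w x * rho + (1 - w x) / rho <= 2 * h - gain.
      have -> : 2 * h = m * rho + (1 - m) / rho.
        by rewrite mrho mh mulfK ?gt_eqF // mulr_natl mulr2n.
      have : 0 <= (w x - (m + eta)) * (rho^-1 - rho).
        by rewrite mulr_ge0 ?subr_ge0 // ltW // (lt_trans rho1) // invf_gt1.
      by rewrite /gain; lra.
    have q0 : 0 <= C.+1%:R / C%:R :> R by rewrite divr_ge0.
    apply: le_trans (ler_wpM2l q0 wx) _.
    by apply: ltW; rewrite [ltRHS]mulrC -ltr_pdivrMr ?mulr_gt0.
  move=> x x1 x2; apply: short => //; apply: leq_trans wide.
  by move: (L n) x1 x2 => l; clear; lia.
have cosp : 0 < cos (pi / s n) by apply: lt_trans cos0; rewrite invr_gt0.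
have : ln (return_prob w (2 * n) 0) <= (2 * n)%N%:R * (ln (2 * h) + ln (cos (pi / s n))).
  rewrite -lnM ?posrE ?mulr_gt0 // mulr_natl -lnXn ?mulr_gt0 //.
  by rewrite ler_ln ?posrE ?u_gt0 // exprn_gt0 // !mulr_gt0.
have lncos := ln_le_subr1 cosp.
rewrite /log_deviation rate natrM => lnu.
have {}lnu : ln (return_prob w (2 * n) 0) + 2 * n%:R * (- ln (2 * h)) <=
    n%:R * (2 * (cos (pi / s n) - 1)).
  have := ler_wpM2l (ltW nR) lncos; lra.
have f0 : 0 <= ln n%:R ^+ 2 / n%:R :> R by rewrite divr_ge0 ?sqr_ge0 // ltW.
apply: le_trans (ler_wpM2l f0 lnu) _.
rewrite le_eqVlt; apply/orP; left; apply/eqP.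
have := lt0r_neq0 nR; move: (cos _) (ln _) => co l; move: (n%:R : R) => x x0.
by field.
Unshelve. all: by end_near. Qed.

Lemma log_deviation_lower kappa : - ln al < kappa ->
  (exists M0, forall M, (M0 <= M)%N ->
     exists2 i, (i < (Num.trunc (M%:R / al ^+ M.*2.+1)).+1)%N &
       forall k, (k <= M.*2)%N -> w (i * M.*2.+1 + k)%N%:Z = m) ->
  exists2 v : nat -> R, v @ \oo --> - (pi * kappa) ^+ 2 &
    \forall n \near \oo, v n <= log_deviation n.
Proof.
move=> ka [M0 long].
have /andP[al0 al1] := al01.
have La : 0 < - ln al by rewrite oppr_gt0 ln_lt0 // al0 al1.
have k0 : 0 < kappa := lt_trans La ka.
(* The run has 2M + 1 sites, so its killing interval has length s = 2M + 2. *)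
pose M n := Num.trunc (ln n%:R / (2 * kappa)).
pose s n : R := (M n).+1.*2%:R.
have s0 n : 0 < s n by rewrite /s ltr0n doubleS.
have k20 : 0 < 2 * kappa by rewrite mulr_gt0.
have Mn n : (0 < n)%N -> 2 * kappa * (M n)%:R <= ln n%:R < 2 * kappa * (M n)%:R + 2 * kappa.
  move=> n0; have l0 : 0 <= ln n%:R / (2 * kappa).
    by rewrite divr_ge0 ?ln_ge0 ?(ltW k20) // ler1n.
  have /andP[lo hi] := truncn_itv l0; rewrite -/(M n) in lo hi.
  move: lo hi; rewrite ler_pdivlMr // ltr_pdivrMr // -[(M n).+1%:R]natr1.
  by move=> lo hi; apply/andP; split; lra.
have sE n : s n = 2 * (M n)%:R + 2 by rewrite /s -muln2 natrM -natr1; ring.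
have sD n : (0 < n)%N -> `|kappa * s n - ln n%:R| <= 2 * kappa.
  move=> n0; have /andP[lo hi] := Mn n n0; rewrite sE ler_norml.
  by apply/andP; split; lra.
pose N n := ((Num.trunc ((M n)%:R / al ^+ (M n).*2.+1)).+1 * (M n).*2.+1)%N.
have Nc : (ln n%:R ^+ 2 / n%:R * (N n)%:R) @[n --> \oo] --> (0 : R).
  apply: (@block_position_cvg0 _ al kappa N M) => // n.
    by move=> n0; have /andP[] := Mn n n0.
  rewrite /N natrM ler_wpM2r // -natr1 lerD2r truncn_le.
  by rewrite divr_ge0 // exprn_ge0 // ltW.
have cosc := cvg_cos_angle k0 s0 sD.
(* The travel cost c ^ (2N) rho ^ M is at least exp (- E N), since M <= N and rho < 1. *)
pose E := - (2 * ln c + ln rho).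
(* The inverse cosine comes from ln x >= (x - 1) / x and tends to 1. *)
exists (fun n => 2 * ln n%:R ^+ 2 * (cos (pi / s n) - 1) * (cos (pi / s n))^-1
   - E * (ln n%:R ^+ 2 / n%:R * (N n)%:R)).
  have -> : - (pi * kappa) ^+ 2 = - (pi * kappa) ^+ 2 * 1^-1 - E * 0 :> R.
    by rewrite invr1 mulr1 mulr0 subr0.
  apply: cvgB; last by apply: cvgM => //; exact: cvg_cst.
  apply: cvgM; first exact: cvg_ln_cos_angle k0 s0 sD.
  by apply: cvgV => //; exact: oner_neq0.
have lnc := @cvg_ln_nat R.
near=> n.
have n0 : (0 < n)%N by near: n; exact: nbhs_infty_gt.
have nR : 0 < n%:R :> R by rewrite ltr0n.
have ln1 : 1 <= ln n%:R :> R by near: n; move/cvgryPge: lnc; exact.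
have /andP[lo hi] := Mn n n0.
have MM0 : (M0 <= M n)%N.
  have : 2 * kappa * M0%:R <= ln n%:R by near: n; move/cvgryPge: lnc; exact.
  move=> /le_lt_trans /(_ hi); rewrite -[X in _ < _ + X]mulr1 -mulrDr ltr_pM2l //.
  by rewrite natr1 ltr_nat ltnS.
have Nn : (N n <= n)%N.
  have : ln n%:R ^+ 2 / n%:R * (N n)%:R < 1 :> R by near: n; apply: (cvgr_lt _ Nc).
  rewrite mulrAC ltr_pdivrMr // mul1r => Nlt.
  rewrite -(ler_nat R) ltW //; apply: le_lt_trans Nlt.
  by rewrite ler_peMl // expr_ge1 //; lra.
have cos0 : 0 < cos (pi / s n) by near: n; apply: (cvgr_gt _ cosc).
have [i iB run] := long _ MM0.
have aN : (i * (M n).*2.+1 + (M n).*2 <= N n)%N.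
  apply: (@leq_trans (i.+1 * (M n).*2.+1)); first by rewrite mulSn addnC leq_add2r.
  by rewrite /N leq_mul2r iB orbT.
have MN : (M n <= N n)%N by apply: leq_trans aN; rewrite -addnn addnA leq_addl.
have c01 : 0 <= c <= 1 by rewrite c1 ltW.
have rho01 : 0 < rho <= 1 by rewrite rho0 ltW.
have h01 : 0 <= 2 * h <= 1 by rewrite h2_le1 andbT mulr_ge0 // ltW.
have low := return_prob_lower w01 c01 cw mrho mh rho01 h01 run aN Nn.
rewrite -/(s n) in low.
have : (2 * N n)%N%:R * ln c + (M n)%:R * ln rho
    + (2 * n)%N%:R * (ln (2 * h) + ln (cos (pi / s n))) <= ln (return_prob w (2 * n) 0).
  have hp : 0 < 2 * h by rewrite mulr_gt0.
  have hcp : 0 < 2 * h * cos (pi / s n) by rewrite mulr_gt0.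
  have p1 : 0 < c ^+ (2 * N n) by rewrite exprn_gt0.
  have p2 : 0 < rho ^+ M n by rewrite exprn_gt0.
  have p3 : 0 < (2 * h * cos (pi / s n)) ^+ (2 * n) by rewrite exprn_gt0.
  have p12 := mulr_gt0 p1 p2; have p123 := mulr_gt0 p12 p3.
  have := low; rewrite -ler_ln ?posrE ?u_gt0 // lnM ?posrE // lnM ?posrE // !lnXn //.
  rewrite [ln (2 * h * _)]lnM ?posrE //.
  by rewrite -[ln c *+ _]mulr_natl -[ln rho *+ _]mulr_natl -[(_ + ln (cos _)) *+ _]mulr_natl.
have lncos := ln_ge_subr1_div cos0.
rewrite /log_deviation rate [(2 * N n)%N%:R]natrM [(2 * n)%N%:R]natrM => lnu.
have lrho : ln rho <= 0 by rewrite ln_le0 // ltW.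
have lnu' : n%:R * (2 * ((cos (pi / s n) - 1) / cos (pi / s n))) - E * (N n)%:R <=
    ln (return_prob w (2 * n) 0) + 2 * n%:R * (- ln (2 * h)).
  have h1 := ler_wpM2l (ltW nR) lncos.
  have h3 : (N n)%:R * ln rho <= (M n)%:R * ln rho by rewrite ler_wnM2r ?ler_nat.
  by rewrite /E; clear ln1 lo hi Nn iB run aN MN low lrho; lra.
have f0 : 0 <= ln n%:R ^+ 2 / n%:R :> R by rewrite divr_ge0 ?sqr_ge0 // ltW.
apply: le_trans (ler_wpM2l f0 lnu').
rewrite le_eqVlt; apply/orP; left; apply/eqP.
have := lt0r_neq0 cos0; have := lt0r_neq0 nR.
move: (cos _) (ln n%:R) (N n)%:R => co l y; move: (n%:R : R) => x x0 co0.
by field; rewrite x0 co0.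
Unshelve. all: by end_near. Qed.

End quenched_asymptotics.

(** * Letting kappa tend to Lambda *)

Lemma squeeze_family (R : realType) (s : nat -> R) (f : R -> R) (l : R) :
  {for l, continuous f} ->
  (forall k : nat, exists2 v : nat -> R, v @ \oo --> f (l * (1 - k.+2%:R^-1)) &
     \forall n \near \oo, s n <= v n) ->
  (forall k : nat, exists2 v : nat -> R, v @ \oo --> f (l * (1 + k.+2%:R^-1)) &
     \forall n \near \oo, v n <= s n) ->
  s @ \oo --> f l.
Proof.
move=> fc upper lower.
have inv0 : (k.+2%:R^-1 : R) @[k --> \oo] --> (0 : R).
  apply/gtr0_cvgV0; first exact: nearW.
  apply/cvgryPge => A; near=> k; apply: (@le_trans _ _ k%:R); last by rewrite ler_nat leqW.
  by near: k; exact: nbhs_infty_ger.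
have up : f (l * (1 - k.+2%:R^-1)) @[k --> \oo] --> f l.
  have g : (l * (1 - k.+2%:R^-1)) @[k --> \oo] --> l.
    rewrite -[X in _ --> X]mulr1 -[X in _ * X]subr0.
    by apply: cvgM; [exact: cvg_cst|apply: cvgB => //; exact: cvg_cst].
  exact: (cvg_comp _ f g fc).
have lo : f (l * (1 + k.+2%:R^-1)) @[k --> \oo] --> f l.
  have g : (l * (1 + k.+2%:R^-1)) @[k --> \oo] --> l.
    rewrite -[X in _ --> X]mulr1 -[X in _ * X]addr0.
    by apply: cvgM; [exact: cvg_cst|apply: cvgD => //; exact: cvg_cst].
  exact: (cvg_comp _ f g fc).
apply/cvgrPdist_lt => e e0.
(* First k is fixed by continuity of [f] at [l], separately for each side; only then is n taken
   large. *)
have [k1 _ /(_ _ (leqnn _)) /= hk1] := cvgr_lt _ up (f l + e) ltac:(by rewrite ltrDl).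
have [k2 _ /(_ _ (leqnn _)) /= hk2] := cvgr_gt _ lo (f l - e) ltac:(by rewrite ltrBlDr ltrDl).
have [v1 v1c v1s] := upper k1; have [v2 v2c v2s] := lower k2.
near=> n.
have s1 : s n <= v1 n by near: n.
have s2 : v2 n <= s n by near: n.
have s3 : v1 n < f l + e by near: n; apply: (cvgr_lt _ v1c).
have s4 : f l - e < v2 n by near: n; apply: (cvgr_gt _ v2c).
by rewrite ltr_norml; apply/andP; split; lra.
Unshelve. all: by end_near. Qed.

Unset Implicit Arguments.

Theorem corollary4p4 (R : realType) (P : probability (environment R) R)
  (d : measure_display) (T : measurableType d) (X : nat -> T -> int)
  (Pq : environment R -> probability T R)
  (quenched : forall w : environment R, is_walk_in w X (Pq w))
  (iid : iid_sites P)
  (elliptic : exists c : R, 0 < c /\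
     forall x : int, P [set w : environment R | c <= w x <= 1 - c] = 1%E)
  (omega_min_gt : 2^-1 < omega_min P)
  (alpha01 : 0 < alpha P < 1)
  (gap : exists eta : R, 0 < eta /\
     P [set w : environment R | omega_min P < w 0 < omega_min P + eta] = 0%E) :
  {ae P, forall w : environment R,
    (fun n : nat => ln n%:R ^+ 2 / n%:R *
       (ln (fine (Pq w [set t | X (2 * n)%N t = 0])) + 2 * n%:R * I0 P))
      @ \oo --> - `|pi * ln (alpha P)| ^+ 2}.
Proof.
have [c [c0 Pc]] := elliptic; have [eta [eta0 Pgap]] := gap.
have /andP[_ m1] := omega_min01 alpha01.
have /andP[al0 al1] := alpha01.
pose Lambda := - ln (alpha P).
have Lambda0 : 0 < Lambda by rewrite oppr_gt0 ln_lt0 // al0 al1.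
(* The shift to k + 2 keeps every kappa below Lambda positive. *)
have k2 (k : nat) : 0 < (k.+2%:R^-1 : R) < 1.
  by rewrite invr_gt0 ltr0n /= invf_lt1 ?ltr0n // ltr1n.
pose kappa (k : nat) := Lambda * (1 - k.+2%:R^-1).
have kappa0 k : 0 < kappa k.
  by have /andP[_ lt1] := k2 k; rewrite mulr_gt0 // subr_gt0.
have kappa_lt k : kappa k < - ln (alpha P).
  by have /andP[gt0 _] := k2 k; rewrite -/Lambda gtr_pMr // ltrBlDr ltrDl.
(* Only countably many kappa are used, so one null set serves them all; the event of [ae_long_run]
   is free of kappa. *)
have short := ae_foralln (fun k => ae_no_long_run iid alpha01 (kappa_lt k) (ltW (kappa0 k))).
have long := ae_long_run iid alpha01.
apply: filterS2 (filterI (ae_elliptic iid (Pc 0)) (ae_gap iid Pgap)) (filterI short long).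
move=> w [cw wgap] [wshort wlong].
have w01 := site01 w.
have uE n : fine (Pq w [set t | X (2 * n)%N t = 0]) = return_prob w (2 * n) 0.
  by rewrite (prob_return (quenched w)).
rewrite (_ : (fun n => _) = log_deviation w (omega_min P)); last first.
  by apply/funext => n; rewrite uE.
have -> : - `|pi * ln (alpha P)| ^+ 2 = - (pi * Lambda) ^+ 2 :> R.
  by rewrite real_normK ?num_real // /Lambda mulrN sqrrN.
apply: (@squeeze_family _ _ (fun x => - (pi * x) ^+ 2)).
- apply: cvgN; rewrite [X in X @ _](_ : _ = (fun x => (pi * x) * (pi * x))) //.
  by apply: cvgM; (apply: cvgM; [exact: cvg_cst|exact: cvg_id]).
- move=> k; exact: (log_deviation_upper w01 omega_min_gt m1 eta0 wgap (kappa0 k) (wshort k)).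
move=> k; apply: (log_deviation_lower w01 omega_min_gt m1 c0 cw alpha01 _ wlong).
have /andP[gt0 _] := k2 k.
by rewrite -/Lambda ltr_pMr // ltrDl.
Qed.
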